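(* Every right amenable subsemigroup $S$ of $\Gamma$ is conjugate to a subsemigroup of $\mathcal Z$.
   Context: $k$ is an algebraically closed field of characteristic zero. The order of a nonzero formal power series over $k$ is the smallest exponent with nonzero coefficient. $\Gamma$ is the semigroup, under composition $\circ$, of (nonzero) formal power series over $k$ of order at least $2$; $k_1[[z]]$ is the group under $\circ$ of series of order exactly $1$. $\mathcal Z$ is the subsemigroup of $\Gamma$ consisting of all monomials $az^n$ with $a\in k^*$, $n\ge2$. Two subsemigroups $S_1,S_2$ of $\Gamma$ are conjugate if there is $\alpha\in k_1[[z]]$ with $\alpha\circ S_1\circ\alpha^{-1}=S_2$. A semigroup $S$ is right amenable if it admits a finitely additive probability measure $\mu$ defined on all subsets of $S$ such that $\mu(Ta^{-1})=\mu(T)$ for all $a\in S$ and $T\subseteq S$, where $Ta^{-1}=\{s\in S : sa\in T\}$. *)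

(* Defs.v *)
From HB Require Import structures.
From mathcomp Require Import all_boot all_order all_algebra.
From mathcomp Require Import boolp classical_sets reals.

Set Implicit Arguments.
Unset Strict Implicit.
Unset Printing Implicit Defensive.

Import Order.TTheory GRing.Theory Num.Theory.
Local Open Scope classical_set_scope.
Local Open Scope ring_scope.

(* [f : fps K] stands for the series \sum_n (f n) z^n.  The ring structures
   that MathComp puts on functions are pointwise, so [f * g] would not be the
   product of series: use [fps_mul]. *)
Definition fps (K : nzRingType) : Type := nat -> K.

Section PowerSeries.
Variable K : nzRingType.
Implicit Types f g : fps K.

Definition fps_monomial (a : K) (n : nat) : fps K :=
  fun i => if i == n then a else 0.

Definition fps_mul f g : fps K :=
  fun n => \sum_(i < n.+1) f i * g (n - i)%N.

Definition fps_exp f (m : nat) : fps K :=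
  iter m (fps_mul f) (fps_monomial 1 0).

(* The substitution f(g(z)) = \sum_i (f i) g(z)^i, meaningful only when
   [g 0 = 0]: then g^i has order at least i, so the terms with [i > n] do not
   contribute to the coefficient of z^n. *)
Definition fps_comp f g : fps K :=
  fun n => \sum_(i < n.+1) f i * fps_exp g i n.

Definition fps_id : fps K := fps_monomial 1 1.

(* The zero series has no order. *)
Definition fps_has_order f (n : nat) : Prop :=
  f n != 0 /\ forall i, (i < n)%N -> f i = 0.

Definition Gamma : set (fps K) :=
  [set f | exists2 n, (2 <= n)%N & fps_has_order f n].

Definition fps1 : set (fps K) := [set f | fps_has_order f 1].

Definition monomials : set (fps K) :=
  [set f | exists a n, [/\ a != 0, (2 <= n)%N & f = fps_monomial a n]].

(* [beta] is the inverse of [alpha] in the group [fps1]. *)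
Definition conjugate (S1 S2 : set (fps K)) : Prop :=
  exists alpha beta : fps K,
    [/\ fps1 alpha, fps1 beta,
        fps_comp alpha beta = fps_id, fps_comp beta alpha = fps_id
      & [set fps_comp (fps_comp alpha s) beta | s in S1] = S2].

End PowerSeries.

Arguments Gamma : clear implicits.
Arguments fps1 : clear implicits.
Arguments monomials : clear implicits.

Section Semigroups.
Variables (T : Type) (op : T -> T -> T).

Definition subsemigroup (A S : set T) : Prop :=
  S `<=` A /\ forall x y, S x -> S y -> S (op x y).

(* Only the values of [mu] on subsets of [S] are relevant.  The normalization
   [mu S = 1] forces [S] to be nonempty. *)
Definition right_amenable (R : realType) (S : set T) : Prop :=
  exists mu : set T -> R,
    [/\ forall A, A `<=` S -> 0 <= mu A,
        mu S = 1,
        forall A B, A `<=` S -> B `<=` S -> A `&` B = set0 ->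
          mu (A `|` B) = mu A + mu B
      & forall a A, S a -> A `<=` S ->
          mu [set s | S s /\ A (op s a)] = mu A].

End Semigroups.

(* Main.v *)
Require Import Defs.
From HB Require Import structures.
From mathcomp Require Import all_boot all_order all_algebra.
From mathcomp Require Import boolp classical_sets reals.
From mathcomp Require Import zify ring lra.

Set Implicit Arguments.
Unset Strict Implicit.
Unset Printing Implicit Defensive.

Import Order.TTheory GRing.Theory Num.Theory.
Local Open Scope classical_set_scope.
Local Open Scope ring_scope.

(* Invariance of the measure gives each left ideal [S a] measure 1, so any two
   of them meet: for all [a], [b] in [S] there are [x], [y] in [S] with
   [x a = y b].  This alone forces linearization.  Conjugate one element of [S]
   to [z^n] by its Boettcher coordinate; then [S] contains all [z^(n^j)].  If
   some [b] in [S] is not a monomial, write [b = c z^m (1 + d z^r + ...)] with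
   [d] nonzero.  The iterates of [b] have the same [r] and arbitrarily large
   order, and if [b'] is one of order greater than [r], then, for every [y], the
   series [y b'] has nonzero coefficients at two exponents that differ by [r].
   As [x (z^(n^j)) = y b'] for some [x], [y] in [S], [n^j] divides [r] for every
   [j], a contradiction. *)

(** * Left ideals of a right amenable semigroup *)

Section Reversibility.
Variables (R : realType) (T : Type) (op : T -> T -> T) (S : set T).
Hypothesis S_closed : forall x y, S x -> S y -> S (op x y).
Hypothesis S_amenable : right_amenable op R S.

(** Additivity on two empty sets gives the empty set measure 0, whereas [S] has measure 1. *)
Lemma right_amenable_nonempty : exists a, S a.
Proof.
have [mu [_ muS muU _]] := S_amenable.
apply: contrapT => S0; have {}S0 : S = set0.
  by apply/seteqP; split=> x // Sx; case: S0; exists x.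
have := muU set0 set0 (sub0set _) (sub0set _) (setI0 _).
rewrite setU0 -S0 muS => /eqP; rewrite -subr_eq0 opprD addrA subrr sub0r.
by rewrite oppr_eq0 oner_eq0.
Qed.

Lemma right_amenable_reversible a b :
  S a -> S b -> exists x y, [/\ S x, S y & op x a = op y b].
Proof.
move=> Sa Sb; have [mu [mu0 muS muU muI]] := S_amenable.
pose ideal c := [set op s c | s in S].
have idealS c : S c -> ideal c `<=` S.
  by move=> Sc _ [s Ss <-]; apply: S_closed.
have mu_ideal c : S c -> mu (ideal c) = 1.
  move=> Sc; rewrite -(muI c) //; last exact: idealS.
  (* Right multiplication by [c] pulls [ideal c] back to all of [S]. *)
  rewrite -muS; congr mu; apply/seteqP; split=> s; first by case.
  by move=> Ss; split=> //; exists s.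
apply: contrapT => disj.
have I0 : ideal a `&` ideal b = set0.
  apply/seteqP; split=> // _ [[x Sx <-] [y Sy yb]].
  by case: disj; exists x, y.
have US : ideal a `|` ideal b `<=` S.
  by move=> x [] /idealS; apply.
have := muU _ _ US (@subDsetl _ S (ideal a `|` ideal b)) (setDIK _ _).
rewrite setDUK // muS muU //; try exact: idealS.
rewrite !mu_ideal //.
have := mu0 _ (@subDsetl _ S (ideal a `|` ideal b)).
by lra.
Qed.

End Reversibility.

(** * Power series through polynomial approximations *)

Section PolyApprox.
Variable K : comNzRingType.
Implicit Types (f g h : fps K) (p q : {poly K}).

Definition poly_approx N p f := forall i, (i < N)%N -> p`_i = f i.

Definition fps_trunc N f : {poly K} := \poly_(i < N) f i.

Lemma fps_truncP N f : poly_approx N (fps_trunc N f) f.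
Proof. by move=> i iN; rewrite coef_poly iN. Qed.

(** Transfers polynomial identities to series: one polynomial approximating both sides to each order
    suffices. *)
Lemma fps_approx_ext f g :
  (forall N, exists2 p, poly_approx N p f & poly_approx N p g) -> f = g.
Proof.
move=> fg; apply/funext => n; have [p pf pg] := fg n.+1.
by rewrite -pf // pg.
Qed.

Lemma poly_approx_mul N p q f g :
  poly_approx N p f -> poly_approx N q g -> poly_approx N (p * q) (fps_mul f g).
Proof.
move=> pf qg i iN; rewrite coefM; apply: eq_bigr => j _.
by rewrite pf ?qg //; have := ltn_ord j; lia.
Qed.

Lemma poly_approx_exp N p f n :
  poly_approx N p f -> poly_approx N (p ^+ n) (fps_exp f n).
Proof.
move=> pf; elim: n => [|n IHn].
  by move=> i _; rewrite coef1 /=/fps_monomial; case: eqP.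
by rewrite exprS; apply: poly_approx_mul.
Qed.

Lemma coef_exp_lt p n i m : (forall j, (j < m)%N -> p`_j = 0) ->
  (i < m * n)%N -> (p ^+ n)`_i = 0.
Proof.
move=> p0; elim: n i => [|n IHn] i; first by rewrite muln0.
move=> imn; rewrite exprS coefM big1 // => j _.
have [jm|mj] := ltnP j m; first by rewrite p0 ?mul0r.
rewrite IHn ?mulr0 //; move: imn (ltn_ord j); rewrite mulnS; lia.
Qed.

Lemma fps_exp_lt f n i m : (forall j, (j < m)%N -> f j = 0) ->
  (i < m * n)%N -> fps_exp f n i = 0.
Proof.
move=> f0 imn; rewrite -(poly_approx_exp n (@fps_truncP i.+1 f)) //.
by apply: (coef_exp_lt _ imn) => j jm; rewrite coef_poly f0 ?if_same.
Qed.

Lemma poly_approx_comp N p q f g : g 0 = 0 ->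
  poly_approx N p f -> poly_approx N q g ->
  poly_approx N (p \Po q) (fps_comp f g).
Proof.
move=> g0 pf qg n nN.
have q0 j : (j < 1)%N -> q`_j = 0 by case: j => // _; rewrite qg //; lia.
rewrite coef_comp_poly.
(* The two sums stop at [size p] and at [n.+1]. Both are padded to [s]: [p] has no coefficients past
   the first bound, and [q ^+ i] has no terms below degree [i]. *)
pose s := maxn (size p) n.+1; pose F i := p`_i * (q ^+ i)`_n.
transitivity (\sum_(i < s) F i).
  rewrite (big_ord_widen_cond s xpredT F) ?leq_maxl //.
  rewrite [RHS](bigID (fun i : 'I_s => (i < size p)%N)) /=.
  rewrite [X in _ = _ + X]big1 ?addr0 //.
  by move=> i; rewrite -leqNgt => pi; rewrite /F nth_default ?mul0r.
rewrite [RHS](_ : _ = \sum_(i < n.+1) F i); last first.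
  apply: eq_bigr => i _; rewrite /F pf ?(poly_approx_exp i qg) //.
  by have := ltn_ord i; lia.
rewrite [RHS](big_ord_widen_cond s xpredT F) ?leq_maxr //.
rewrite [LHS](bigID (fun i : 'I_s => (i < n.+1)%N)) /=.
rewrite [X in _ + X = _]big1 ?addr0 //.
move=> i; rewrite -leqNgt => pi; rewrite /F (coef_exp_lt q0) ?mulr0 //; lia.
Qed.

Lemma fps_comp0 f g : f 0 = 0 -> fps_comp f g 0 = 0.
Proof. by move=> f0; rewrite /fps_comp big_ord1 /= f0 mul0r. Qed.

Lemma fps_compA f g h : g 0 = 0 -> h 0 = 0 ->
  fps_comp (fps_comp f g) h = fps_comp f (fps_comp g h).
Proof.
move=> g0 h0; apply: fps_approx_ext => N.
have [fN gN hN] := And3 (@fps_truncP N f) (@fps_truncP N g) (@fps_truncP N h).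
exists ((fps_trunc N f \Po fps_trunc N g) \Po fps_trunc N h).
  by do 2?[apply: poly_approx_comp => //].
rewrite -comp_polyA.
by do 2?[apply: poly_approx_comp => //]; apply: fps_comp0.
Qed.

Lemma poly_approx_monomial N (a : K) n :
  poly_approx N (a *: 'X^n) (fps_monomial a n).
Proof.
move=> i _; rewrite coefZ coefXn /fps_monomial.
by case: eqP; rewrite ?mulr1 ?mulr0.
Qed.

Lemma poly_approx_id N : poly_approx N 'X (fps_id K).
Proof. by rewrite -['X]scale1r; apply: (@poly_approx_monomial N 1 1). Qed.

Lemma fps_comp_id f : fps_comp f (fps_id K) = f.
Proof.
apply: fps_approx_ext => N; exists (fps_trunc N f);
  last exact: fps_truncP.
rewrite -[fps_trunc N f]comp_polyXr.
apply: poly_approx_comp => //; [exact: fps_truncP | exact: poly_approx_id].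
Qed.

Lemma fps_id_comp f : f 0 = 0 -> fps_comp (fps_id K) f = f.
Proof.
move=> f0; apply: fps_approx_ext => N; exists (fps_trunc N f);
  last exact: fps_truncP.
rewrite -[fps_trunc N f]comp_polyX.
apply: poly_approx_comp => //; [exact: poly_approx_id | exact: fps_truncP].
Qed.

Lemma fps_comp_monomial n f : f 0 = 0 ->
  fps_comp (fps_monomial 1 n) f = fps_exp f n.
Proof.
move=> f0; apply: fps_approx_ext => N; exists (fps_trunc N f ^+ n).
  rewrite -comp_Xn_poly -['X^n]scale1r.
  apply: poly_approx_comp => //; last exact: fps_truncP.
  exact: poly_approx_monomial.
exact/poly_approx_exp/fps_truncP.
Qed.

Lemma fps_exp_monomial (a : K) m n :
  fps_exp (fps_monomial a m) n = fps_monomial (a ^+ n) (m * n).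
Proof.
apply: fps_approx_ext => N; exists ((a *: 'X^m) ^+ n).
  exact/poly_approx_exp/poly_approx_monomial.
rewrite exprZn -exprM; exact: poly_approx_monomial.
Qed.

Lemma fps_comp_monomial_support f N i :
  ~~ (N %| i)%N -> fps_comp f (fps_monomial 1 N) i = 0.
Proof.
move=> Ni; rewrite /fps_comp big1 // => j _; rewrite fps_exp_monomial.
rewrite /fps_monomial ifN ?mulr0 //; apply: contraNneq Ni => ->.
exact: dvdn_mulr.
Qed.

(** Binomial expansion to first order in ['X^r]: [q'] is [n p^(n-1) q] up to a multiple of ['X^r],
    which fixes its constant term. *)
Lemma expr_addXn p q r n : (0 < r)%N ->
  exists2 q', (p + 'X^r * q) ^+ n = p ^+ n + 'X^r * q'
            & q'`_0 = p`_0 ^+ n.-1 * q`_0 *+ n.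
Proof.
move=> r0; elim: n => [|n [q' pn q'0]].
  by exists 0; rewrite ?mulr0 ?addr0 // coef0 mulr0n.
exists (q * p ^+ n + p * q' + 'X^r * (q * q')).
  by rewrite !exprS pn; ring.
rewrite !coefD coefXnM r0 addr0 !coefM !big_ord1 /= subn0 q'0.
have -> : (p ^+ n)`_0 = p`_0 ^+ n.
  by elim: n {pn q'0} => [|n IHn]; rewrite ?coef1 // !exprS coefM big_ord1 IHn.
case: n {pn q'0} => [|n] /=; first by rewrite mulr0n mulr0 addr0 mulr1n mulrC.
by rewrite [in RHS]mulrS mulrnAr mulrA -exprS mulrC.
Qed.

Definition fps_cut j f : fps K := fun i => if (i < j)%N then f i else 0.

(** Course-of-values recursion: [Phi] sees the earlier coefficients as a series padded with
    zeros. *)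
Lemma fps_recursion (Phi : fps K -> nat -> K) :
  exists f, forall j, f j = Phi (fps_cut j f) j.
Proof.
pose step (h : fps K) j : fps K := fun i => if i == j then Phi h j else h i.
(* [u j] holds the first [j] coefficients and is zero beyond, so the solution is read off along the
   diagonal. *)
pose u := fix u j := if j is j'.+1 then step (u j') j' else (fun=> 0) : fps K.
have u_ge j i : (j <= i)%N -> u j i = 0.
  elim: j => // j IHj ji /=; rewrite /step ifN ?IHj //; lia.
have u_lt j i : (i < j)%N -> u j i = u i.+1 i.
  elim: j => // j IHj; rewrite ltnS leq_eqVlt => /predU1P[->//|ij].
  by rewrite -IHj //= {1}/step ifN //; lia.
exists (fun i => u i.+1 i) => j.
have -> : fps_cut j (fun i => u i.+1 i) = u j.
  apply/funext => i; rewrite /fps_cut; case: ltnP => ij; first by rewrite u_lt.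
  by rewrite u_ge.
by rewrite /= {1}/step eqxx.
Qed.

(** Write [f = z (p + z^(j-1) q)], where [z p] collects the terms below [z^j]. Then [f j] enters
    [f^n] no earlier than exponent [n + j - 1], and linearly there, which makes the equations solved
    later triangular. *)
Lemma fps_exp_cut f n j i : f 0 = 0 -> (1 < j)%N -> (i < n + j)%N ->
  fps_exp f n i = fps_exp (fps_cut j f) n i +
    (if i.+1 == (n + j)%N then f 1 ^+ n.-1 * f j *+ n else 0).
Proof.
move=> f0 j1 inj.
pose p : {poly K} := \poly_(k < j.-1) f k.+1.
pose q : {poly K} := \poly_(k < i.+1) f (j + k)%N.
have p_approx : poly_approx i.+1 ('X * p) (fps_cut j f).
  move=> [|k] ki; rewrite coefXM /= /fps_cut ?f0 ?if_same //.
  by rewrite coef_poly; congr (if _ then _ else _); lia.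
have pq_approx : poly_approx i.+1 ('X * (p + 'X^(j.-1) * q)) f.
  move=> [|k] ki; rewrite coefXM /= ?f0 // coefD coefXnM !coef_poly.
  case: ltnP => kj; rewrite ?addr0 // add0r ifT; last by lia.
  by congr f; lia.
rewrite -(poly_approx_exp n pq_approx) // -(poly_approx_exp n p_approx) //.
have [|q' pq q'0] := @expr_addXn p q j.-1 n; first by lia.
rewrite !exprMn pq mulrDr coefD; congr (_ + _); rewrite mulrA -exprD coefXnM.
case: ifP => [inj'|ninj]; first by rewrite ifN //; lia.
rewrite ifT; last by lia.
rewrite (_ : i - _ = 0)%N; last by lia.
rewrite q'0 !coef_poly addn0 ifT //; lia.
Qed.

End PolyApprox.

(** * Lowest terms of powers and of composites *)

Lemma fps_exp_gap (K : comNzRingType) (f : fps K) m r n i :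
  (0 < r)%N -> (forall j, (j < m)%N -> f j = 0) ->
  (forall j, (m < j < m + r)%N -> f j = 0) -> (i <= m * n + r)%N ->
  fps_exp f n i = (if i == (m * n)%N then f m ^+ n else 0) +
    (if i == (m * n + r)%N then f m ^+ n.-1 * f (m + r)%N *+ n else 0).
Proof.
move=> r0 fm fr ile.
(* Up to exponent [i], [f = z^m (f m + z^r q)], so [expr_addXn] gives the terms of the power through
   [m * n + r]. *)
pose q : {poly K} := \poly_(k < i.+1) f (m + r + k)%N.
have q_approx : poly_approx i.+1 ('X^m * ((f m)%:P + 'X^r * q)) f.
  move=> k ki; rewrite coefXnM; case: ltnP => km; first by rewrite fm.
  rewrite coefD coefC coefXnM coef_poly; case: eqP => [km0|/eqP km0].
    by rewrite km0 r0 addr0; congr f; lia.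
  rewrite add0r; case: ltnP => kr; first by rewrite fr //; lia.
  by rewrite ifT; [congr f; lia | lia].
rewrite -(poly_approx_exp n q_approx) // exprMn -exprM.
have [q' -> q'0] := expr_addXn (f m)%:P q n r0.
rewrite coefXnM -polyC_exp coefD coefC coefXnM.
have [i_lt|i_ge] := ltnP i (m * n).
  by rewrite !ifN ?addr0 //; lia.
rewrite subn_eq0 eqn_leq i_ge andbT; congr (_ + _).
case: ltnP => ir; first by rewrite ifN //; lia.
rewrite ifT; last by lia.
rewrite (_ : _ - r = 0)%N; last by lia.
by rewrite q'0 coefC coef_poly addn0.
Qed.

(** Past index [l], a term of the substitution either has zero coefficient or starts at an exponent
    [m * i] exceeding [s]. *)
Lemma fps_comp_low (K : comNzRingType) (f g : fps K) l m s t :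
  (0 < m)%N -> (forall i, (i < l)%N -> f i = 0) ->
  (forall i, (i < m)%N -> g i = 0) ->
  (forall i, (l < i)%N -> (m * i <= s)%N -> f i = 0) -> (t <= s)%N ->
  fps_comp f g t = f l * fps_exp g l t.
Proof.
move=> m0 fl gm fs ts.
have term0 i : i != l -> f i * fps_exp g i t = 0.
  rewrite neq_ltn => /orP[/fl ->|li]; first by rewrite mul0r.
  have [mi|mi] := leqP (m * i) s; first by rewrite fs ?mul0r.
  by rewrite (fps_exp_lt gm) ?mulr0 //; lia.
rewrite /fps_comp; have [lt|tl] := ltnP l t.+1.
  rewrite (bigD1 (Ordinal lt)) //= big1 ?addr0 // => i il.
  by apply: term0; apply: contraNneq il => il; apply/eqP/val_inj.
(* For [t < l] the index [l] lies outside the sum, but then [g^l] starts beyond [t] as well. *)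
rewrite (fps_exp_lt gm) ?mulr0; last by nia.
by rewrite big1 // => i _; apply: term0; have := ltn_ord i; lia.
Qed.

Lemma fps_has_order_comp (K : idomainType) (f g : fps K) l m :
  (0 < m)%N -> fps_has_order f l -> fps_has_order g m ->
  fps_has_order (fps_comp f g) (m * l).
Proof.
move=> m0 [fl fl0] [gm gm0].
have low t : (t <= m * l)%N -> fps_comp f g t = f l * fps_exp g l t.
  by apply: (fps_comp_low m0 fl0 gm0) => i li mi; nia.
split=> [|t tml]; last by rewrite low ?(fps_exp_lt gm0) ?mulr0 //; lia.
rewrite low // (@fps_exp_gap _ _ m 1) //; [|by move=> j; lia|by lia].
rewrite eqxx ifN ?addr0; last by lia.
by rewrite mulf_neq0 ?expf_neq0.
Qed.

Lemma Gamma_comp (K : idomainType) (f g : fps K) l m :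
  (0 < l)%N -> (0 < m)%N -> (2 <= l * m)%N ->
  fps_has_order f l -> fps_has_order g m -> Gamma K (fps_comp f g).
Proof.
move=> l0 m0 lm fl gm; exists (m * l)%N; first by rewrite mulnC.
exact: fps_has_order_comp.
Qed.

(* [f = c z^m (1 + d z^r + O(z^(r+1)))] with [c, d] nonzero *)
Definition fps_gap (K : nzRingType) (f : fps K) m r :=
  [/\ fps_has_order f m, forall j, (m < j < m + r)%N -> f j = 0
    & f (m + r)%N != 0].

Lemma Gamma_fps_gap (K : nzRingType) (f : fps K) : Gamma K f ->
  monomials K f \/ exists m r, [/\ (2 <= m)%N, (0 < r)%N & fps_gap f m r].
Proof.
move=> [m m2 fm]; have [fm0 fm_lt] := fm.
have [exr|nexr] := pselect (exists r, (0 < r)%N && (f (m + r)%N != 0)).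
  right; have [r /andP[r0 fr] r_min] := ex_minnP exr.
  exists m, r; split=> //; split=> // j jmr.
  apply: contrapT => /eqP fj; have := r_min (j - m)%N.
  by rewrite subnKC ?fj; lia.
left; exists (f m), m; split=> //; apply/funext => i; rewrite /fps_monomial.
case: ltngtP => [/fm_lt//|mi|->//].
apply: contrapT => /eqP fi; apply: nexr; exists (i - m)%N.
by rewrite subnKC ?fi; lia.
Qed.

(** * Gaps between the two lowest exponents in characteristic zero *)

Section CharacteristicZero.
Variable K : idomainType.
Hypothesis char0 : [pchar K] =i pred0.

(** Through exponent [m * l + r] only the term [f l * g^l] counts. Its coefficient at that exponent
    is [l] times a nonzero product, hence nonzero in characteristic zero. *)
Lemma fps_gap_comp (f g : fps K) l m r :
  (0 < l)%N -> (0 < m)%N -> (0 < r)%N ->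
  fps_has_order f l ->
  (forall i, (l < i)%N -> (m * i <= m * l + r)%N -> f i = 0) ->
  fps_gap g m r -> fps_gap (fps_comp f g) (m * l) r.
Proof.
move=> l0 m0 r0 fl_ord f0 [gm_ord g_gap gr].
have [fl fl0] := fl_ord; have [gm gm0] := gm_ord.
have low t : (t <= m * l + r)%N -> fps_comp f g t = f l * fps_exp g l t.
  exact: fps_comp_low m0 fl0 gm0 f0.
split; first exact: fps_has_order_comp.
- move=> j jlr; rewrite low; last by lia.
  by rewrite (fps_exp_gap r0 gm0 g_gap) ?ifN ?addr0 ?mulr0 //; lia.
- rewrite low // (fps_exp_gap r0 gm0 g_gap) // eqxx ifN ?add0r; last by lia.
  rewrite mulf_neq0 // -mulr_natr !mulf_neq0 ?expf_neq0 //.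
  by have /pcharf0P -> := char0; lia.
Qed.

(** Substituting an iterate of order at least 2 into [f] pushes the second term of [f] past the gap
    [r], so the gap of the iterate survives. *)
Lemma fps_gap_iter (S : set (fps K)) f m r j :
  (forall f g, S f -> S g -> S (fps_comp f g)) -> S f ->
  (2 <= m)%N -> (0 < r)%N -> fps_gap f m r ->
  exists2 g, S g & fps_gap g (m ^ j.+1) r.
Proof.
move=> S_closed Sf m2 r0 f_gap; have [f_ord f0 _] := f_gap.
elim: j => [|j [g Sg g_gap]]; first by exists f.
have mj : (2 <= m ^ j.+1)%N by apply: leq_ltn_trans (ltn_expl j.+1 m2).
exists (fps_comp f g); first exact: S_closed.
rewrite expnSr; apply: fps_gap_comp => //; try lia.
by move=> i mi mjr; apply: f0; nia.
Qed.

Lemma reversible_monomials (S : set (fps K)) n :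
  subsemigroup (@fps_comp K) (Gamma K) S ->
  (forall a b, S a -> S b ->
    exists x y, [/\ S x, S y & fps_comp x a = fps_comp y b]) ->
  (2 <= n)%N -> S (fps_monomial 1 n) -> S `<=` monomials K.
Proof.
move=> [S_Gamma S_closed] S_rev n2 Sn b Sb.
have [//|[m [r [m2 r0 b_gap]]]] := Gamma_fps_gap (S_Gamma _ Sb).
have Snj j : S (fps_monomial 1 (n ^ j.+1)).
  elim: j => [|j IHj] //; have := S_closed _ _ Sn IHj.
  rewrite fps_comp_monomial; last by rewrite /fps_monomial ifN //; lia.
  by rewrite fps_exp_monomial expr1n -expnSr.
(* The exponent [r.+1] makes both [m ^ r.+1] and [n ^ r.+1] exceed [r]. *)
have [b' Sb' b'_gap] := fps_gap_iter r S_closed Sb m2 r0 b_gap.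
have [x [y [Sx Sy xy]]] := S_rev _ _ (Snj r) Sb'.
have [l l2 y_ord] := S_Gamma _ Sy.
have mr : (r < m ^ r.+1)%N by apply/ltnW/ltn_expl.
have nr : (r < n ^ r.+1)%N by apply/ltnW/ltn_expl.
(* The two bounds on [i] are incompatible because [r < m ^ r.+1]. *)
have y_gap i : (l < i)%N -> (m ^ r.+1 * i <= m ^ r.+1 * l + r)%N -> y i = 0.
  by move=> li; nia.
have [| |[yb_ord _] _ yb_r] := fps_gap_comp _ _ r0 y_ord y_gap b'_gap; try lia.
have dvd i : fps_comp y b' i != 0 -> (n ^ r.+1 %| i)%N.
  by rewrite -xy; apply: contraR => /fps_comp_monomial_support ->.
have := dvd _ yb_r; rewrite (dvdn_addr _ (dvd _ yb_ord)) => /(dvdn_leq r0); lia.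
Qed.

End CharacteristicZero.

(** * Compositional inverses and Boettcher coordinates *)

Lemma fps_exp1 (K : comNzRingType) (f : fps K) : fps_exp f 1 = f.
Proof.
apply: fps_approx_ext => N; exists (fps_trunc N f);
  last exact: fps_truncP.
exact: (poly_approx_exp 1 (@fps_truncP _ N f)).
Qed.

(** For [i >= 2], [g t] enters [g^i] only beyond [z^t], so at [z^t] it is felt by the linear term of
    [f] alone. *)
Lemma fps_comp_cut (K : comNzRingType) (f g : fps K) t : g 0 = 0 ->
  (1 < t)%N -> fps_comp f g t = fps_comp f (fps_cut t g) t + f 1 * g t.
Proof.
case: t => [|[|t]] // g0 t1.
rewrite /fps_comp 2![in LHS]big_ord_recl 2![in RHS]big_ord_recl.
rewrite -[RHS]addrA; congr (_ + _); rewrite [RHS]addrAC; congr (_ + _).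
  by rewrite (@fps_exp_cut _ g 1 t.+2) // eqxx /= mul1r mulr1n mulrDr.
apply: eq_bigr => i _; congr (_ * _).
have it : (t.+2 < i.+2 + t.+2)%N by lia.
by rewrite (fps_exp_cut g0 t1 it) ifN ?addr0 //; lia.
Qed.

Section Conjugation.
Variable K : fieldType.
Implicit Types f g : fps K.

Lemma fps1_right_inverse f : fps1 K f ->
  exists2 g, fps1 K g & fps_comp f g = fps_id K.
Proof.
move=> [f1 /(_ 0 isT) f0].
(* The equation at [z^j] is linear in [g j] with coefficient [f 1], hence solvable from the earlier
   coefficients. *)
have [g g_rec] := fps_recursion (fun h j => if (j < 2)%N
  then fps_monomial (f 1)^-1 1 j else - fps_comp f h j / f 1).
have g0 : g 0 = 0 by rewrite g_rec.
have g1 : g 1 = (f 1)^-1 by rewrite g_rec.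
exists g; first by split; [rewrite g1 invr_eq0 | case].
apply/funext => -[|[|j]].
- by rewrite fps_comp0.
- rewrite /fps_comp !big_ord_recl big_ord0 f0 mul0r add0r addr0 fps_exp1.
  by rewrite g1 divff.
- rewrite fps_comp_cut // [X in f 1 * X]g_rec /= [f 1 * _]mulrC divfK //.
  by rewrite subrr.
Qed.

(** The usual group argument: with [h] a right inverse of [g], associativity gives
    [f = f(g(h)) = h]. *)
Lemma fps1_inverse f : fps1 K f ->
  exists g, [/\ fps1 K g, fps_comp f g = fps_id K & fps_comp g f = fps_id K].
Proof.
move=> f1; have [g g1 fg] := fps1_right_inverse f1.
have [h h1 gh] := fps1_right_inverse g1.
have [[_ /(_ 0 isT) f0] [_ /(_ 0 isT) g0] [_ /(_ 0 isT) h0]] := And3 f1 g1 h1.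
exists g; split=> //.
suff -> : f = h by [].
by rewrite -[LHS]fps_comp_id -gh -fps_compA // fg fps_id_comp.
Qed.

(* Comparing the coefficients of [z^(n - 1 + j)] in [alpha(f) = alpha^n] gives
   [alpha j] in terms of the previous ones, as [alpha^n] contributes
   [n c^(n - 1) (alpha j)] and [alpha(f)] only involves [alpha i] for
   [n i <= n - 1 + j], hence [i < j]. *)
Lemma boettcher f n c : [pchar K] =i pred0 -> (2 <= n)%N ->
  fps_has_order f n -> c != 0 -> c ^+ n.-1 = f n ->
  exists2 alpha, fps1 K alpha &
    fps_comp alpha f = fps_comp (fps_monomial 1 n) alpha.
Proof.
move=> char0 n2 [fn f_lt] c0 cf.
have cn0 : c ^+ n.-1 *+ n != 0.
  rewrite -mulr_natr mulf_neq0 ?expf_neq0 //.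
  by have /pcharf0P -> := char0; lia.
(* The recursion starts from [c z]; the choice of [c] settles the equation at [z^n], namely
   [c (f n) = c^n]. *)
have [a a_rec] := fps_recursion (fun h j => if (j < 2)%N then fps_monomial c 1 j
  else (fps_comp h f (n.-1 + j)%N - fps_exp h n (n.-1 + j)%N) /
    (c ^+ n.-1 *+ n)).
have a0 : a 0 = 0 by rewrite a_rec.
have a1 : a 1 = c by rewrite a_rec.
have a_lt i : (i < 1)%N -> a i = 0 by case: i.
exists a; first by split; rewrite ?a1.
rewrite fps_comp_monomial //; apply/funext => t.
have low : (t <= n)%N -> fps_comp a f t = a 1 * fps_exp f 1 t.
  move=> tn; apply: (@fps_comp_low _ _ _ 1 n n) => //; first by lia.
  by move=> i i1 ni; nia.
have [tn|nt|tn] := ltngtP t n.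
- rewrite (low (ltnW tn)) fps_exp1 f_lt // mulr0.
  by rewrite (fps_exp_lt a_lt) ?mul1n.
- pose j := (t - n.-1)%N.
  have j1 : (1 < j)%N by rewrite /j; lia.
  have tE : t = (n.-1 + j)%N by rewrite /j; lia.
  rewrite (@fps_exp_cut _ _ n j) //; last by lia.
  rewrite ifT; last by lia.
  rewrite -mulrnAl a1 [X in _ * X]a_rec ltnNge j1 /= -tE mulrC divfK //.
  rewrite addrC subrK; apply: eq_bigr => i _.
  (* For [i >= j], [f^i] starts at [n * i > n - 1 + j], so cutting [a] at [j] does not change this
     coefficient. *)
  rewrite /fps_cut; case: ltnP => // ji.
  by rewrite (fps_exp_lt f_lt) ?mulr0 ?mul0r //; nia.
- rewrite low ?tn // fps_exp1 a1 -cf -exprS prednK; last by lia.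
  have a_gap i : (1 < i < 1 + 1)%N -> a i = 0 by lia.
  rewrite (fps_exp_gap _ a_lt a_gap) ?mul1n ?leq_addr // eqxx ifN; last by lia.
  by rewrite addr0 a1.
Qed.

End Conjugation.

Lemma closedField_root (k : closedFieldType) n (a : k) : (0 < n)%N ->
  a != 0 -> exists2 c, c != 0 & c ^+ n = a.
Proof.
move=> n0 a0; have [c] := solve_monicpoly (fun i => if i == 0 then a else 0) n0.
case: n n0 => // n _; rewrite big_ord_recl /= mulr1 big1 => [cn|i _];
  last by rewrite mul0r.
exists c; last by rewrite cn addr0.
by apply: contraNneq a0 => c0; move: cn; rewrite c0 exprS mul0r addr0 => <-.
Qed.

Theorem theorem1p5 (R : realType) (k : closedFieldType)
    (k_char0 : [pchar k] =i pred0) (S : set (fps k))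
    (S_sub : subsemigroup (@fps_comp k) (Gamma k) S)
    (S_amenable : right_amenable (@fps_comp k) R S) :
  exists S' : set (fps k),
    subsemigroup (@fps_comp k) (monomials k) S' /\ conjugate S S'.
Proof.
have [S_Gamma S_closed] := S_sub.
have [a Sa] := right_amenable_nonempty S_amenable.
have [n n2 a_ord] := S_Gamma _ Sa.
have n1 : (0 < n.-1)%N by lia.
have [c c0 cn] := closedField_root n1 a_ord.1.
have [alpha alpha1 alpha_a] := boettcher k_char0 n2 a_ord c0 cn.
have [beta [beta1 alphaK betaK]] := fps1_inverse alpha1.
have [[_ /(_ 0 isT) alpha0] [_ /(_ 0 isT) beta0]] := conj alpha1 beta1.
have S0 s : S s -> s 0 = 0.
  by move=> /S_Gamma[m m2 [_ ->]] //; lia.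
pose conj_alpha (s : fps k) := fps_comp (fps_comp alpha s) beta.
pose S' := [set conj_alpha s | s in S].
(* Conjugation is a morphism since [beta] inverts [alpha]; closure and reversibility pass to [S']
   through it, without a measure on [S']. *)
have conjM s t : S s -> S t ->
    fps_comp (conj_alpha s) (conj_alpha t) = conj_alpha (fps_comp s t).
  move=> /S0 s0 /S0 t0; rewrite /conj_alpha fps_compA ?fps_comp0 //.
  rewrite -(@fps_compA _ beta) ?fps_comp0 // -(@fps_compA _ beta) //.
  by rewrite betaK fps_id_comp // -fps_compA // (@fps_compA _ alpha).
have S'_closed x y : S' x -> S' y -> S' (fps_comp x y).
  move=> [s Ss <-] [t St <-]; exists (fps_comp s t); first exact: S_closed.
  by rewrite conjM.
exists S'; split; last by exists alpha, beta.
split=> //; apply: (@reversible_monomials _ k_char0 S' n) => //.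
- split=> // _ [s Ss <-]; have [m m2 s_ord] := S_Gamma _ Ss.
  apply: (@Gamma_comp _ _ _ m 1) => //; try lia.
  by rewrite -[m]muln1; apply: fps_has_order_comp => //; lia.
- move=> _ _ [s Ss <-] [t St <-].
  have [x [y [Sx Sy xy]]] :=
    right_amenable_reversible S_closed S_amenable Ss St.
  exists (conj_alpha x), (conj_alpha y); split; [by exists x | by exists y |].
  by rewrite !conjM // xy.
- exists a => //; rewrite /conj_alpha alpha_a fps_compA // alphaK.
  exact: fps_comp_id.
Qed.
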